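(* Let $0<\varepsilon\le 0.5$ and $0<\delta\le 0.25$ be constants. There is a randomized algorithm which, given a graph $G=(V,E)$ with $n$ vertices, $m=\Omega(n^{1+3.82\delta})$ edges and $t=\Omega(m^{1+\delta})$ triangles, finds the following with high probability: (i) an estimate lying in the interval $[(1-\varepsilon)t,(1+\varepsilon)t]$ of the number $t$ of triangles in $G$; (ii) a triangle in $G$. The expected running time of the algorithm for items (i) and (ii) is $O\big(n^{\omega(1-\delta)}\big)$ or $O\big((m n^{-2\delta})^{\frac{2\omega}{\omega+1}}\big)$; for item (i) an additional factor of $\varepsilon^{-2}$ is incurred.
   Context: Graphs are finite, simple and undirected. A triangle is a set of three pairwise adjacent vertices. $\omega<2.376$ denotes the exponent of matrix multiplication (so that two $n\times n$ matrices can be multiplied in $O(n^\omega)$ time). ''With high probability'' means with probability tending to $1$ as $n\to\infty$. *)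

(* Defs.v *)
From HB Require Import structures.
From mathcomp Require Export all_boot all_order all_algebra.
From mathcomp Require Export all_classical all_reals all_analysis.

Set Implicit Arguments.
Unset Strict Implicit.
Unset Printing Implicit Defensive.

Import Order.TTheory GRing.Theory Num.Theory.
Local Open Scope ring_scope.

(** * Graphs *)

Record sgraph (n : nat) := SGraph {
  adj :> rel 'I_n;
  adj_sym : symmetric adj;
  adj_irr : irreflexive adj }.

Definition edges n (G : sgraph n) : {set {set 'I_n}} :=
  [set E : {set 'I_n} | [exists u, exists v, (E == [set u; v]) && G u v]].

Definition is_triangle n (G : sgraph n) (T : {set 'I_n}) : bool :=
  (#|T| == 3)%N && [forall u in T, forall v in T, (u != v) ==> G u v].

Definition nb_edges n (G : sgraph n) : nat := #|edges G|.

Definition nb_triangles n (G : sgraph n) : nat :=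
  #|[set T : {set 'I_n} | is_triangle G T]|.

(** * Randomized word RAM

   Programs work on scalar variables and arrays whose names are fixed by the
   program text and whose cells are words, that is, elements of
   {0, ..., W - 1}; addresses are words as well.  Every elementary command
   costs one time unit: the expressions it evaluates have a size bounded by
   the (fixed) program, hence take constantly many word operations. *)

Inductive binop := Add | Sub | Mul | Div | Mod | Eq | Lt.

Inductive expr :=
  | Const of nat
  | Var of nat
  | Get of nat & expr
  | Bin of binop & expr & expr.

Inductive cmd :=
  | Skip
  | Assign of nat & expr
  | Store of nat & expr & expr
  | Rand of nat & expr
  | Seq of cmd & cmd
  | If of expr & cmd & cmd
  | While of expr & cmd.

Record state := State {
  var : nat -> nat;
  arr : nat -> nat -> nat }.

Definition set_var (s : state) (x v : nat) : state :=
  State (fun y => if y == x then v else var s y) (arr s).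

Definition set_arr (s : state) (a i v : nat) : state :=
  State (var s)
        (fun b j => if (b == a) && (j == i) then v else arr s b j).

(* [Sub] is truncated at 0; [Div] by 0 yields 0 and [Mod] by 0 is the
   identity, as in [div.v]. *)
Definition binop_fun (o : binop) : nat -> nat -> nat :=
  match o with
  | Add => addn
  | Sub => subn
  | Mul => muln
  | Div => divn
  | Mod => modn
  | Eq => fun a b => (a == b)%N
  | Lt => fun a b => (a < b)%N
  end.

Fixpoint eval (W : nat) (s : state) (e : expr) : nat :=
  match e with
  | Const c => c %% W
  | Var x => var s x
  | Get a e1 => arr s a (eval W s e1)
  | Bin o e1 e2 => binop_fun o (eval W s e1) (eval W s e2) %% W
  end%N.

(* A stack of commands still to be executed, and the memory; the computation
   has halted when the stack is empty. *)
Definition config := (seq cmd * state)%type.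

(* The nonempty sequence of equiprobable successor configurations when [c] is
   on top of the stack [K].  [Rand x e] draws [x] uniformly from
   {0, ..., e - 1} (and sets it to 0 when [e] evaluates to 0). *)
Definition step (W : nat) (c : cmd) (K : seq cmd) (s : state) : seq config :=
  match c with
  | Skip => [:: (K, s)]
  | Assign x e => [:: (K, set_var s x (eval W s e))]
  | Store a e1 e2 => [:: (K, set_arr s a (eval W s e1) (eval W s e2))]
  | Rand x e => [seq (K, set_var s x v) | v <- iota 0 (maxn 1 (eval W s e))]
  | Seq c1 c2 => [:: (c1 :: c2 :: K, s)]
  | If e c1 c2 => [:: ((if eval W s e != 0%N then c1 else c2) :: K, s)]
  | While e c1 =>
      [:: (if eval W s e != 0%N then c1 :: While e c1 :: K else K, s)]
  end.

Definition average (R : realType) (T : Type) (f : T -> R) (l : seq T) : R :=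
  (\sum_(x <- l) f x) / (size l)%:R.

(* Probability that the computation halts within [t] steps in a state of [Q] *)
Fixpoint prob_within (R : realType) (W : nat) (Q : set state) (t : nat)
    (k : config) : R :=
  match k.1, t with
  | [::], _ => \1_Q k.2
  | _, 0%N => 0
  | c :: K, t'.+1 => average (@prob_within R W Q t') (step W c K k.2)
  end.

(* Expectation of the minimum of [t] and the number of steps until halting *)
Fixpoint trunc_time (R : realType) (W : nat) (t : nat) (k : config) : R :=
  match k.1, t with
  | [::], _ => 0
  | _, 0%N => 0
  | c :: K, t'.+1 => 1 + average (@trunc_time R W t') (step W c K k.2)
  end.

Definition success_prob (R : realType) (W : nat) (Q : set state) (p : cmd)
    (s : state) : R :=
  sup (range (fun t => prob_within R W Q t ([:: p], s))).

Definition expected_time (R : realType) (W : nat) (p : cmd) (s : state)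
    : \bar R :=
  ereal_sup (range (fun t => (trunc_time R W t ([:: p], s))%:E)).

(* A program together with the constant governing its word length: on inputs
   of size [n] it must meet its specification and its time bound for every
   word length of at least [wexp * log (n + 2)] bits, in particular for words
   of O(log n) bits. *)
Record algorithm := Algorithm { prog : cmd; wexp : nat }.

Definition word_ok (al : algorithm) (n W : nat) : Prop :=
  ((n + 2) ^ wexp al <= W)%N.

(** * Matrix multiplication *)

(* Variable 0 holds the dimension [N]; arrays 0 and 1 hold the factors, row by
   row; all other cells are 0. *)
Definition mx_input N (A B : 'M[nat]_N) : state :=
  let flat (M : 'M[nat]_N) k :=
    match insub (k %/ N)%N, insub (k %% N)%N with
    | Some i, Some j => M i j
    | _, _ => 0%N
    end in
  State (fun x => if x == 0%N then N else 0%N)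
        (fun a => match a with
                  | 0 => flat A
                  | 1 => flat B
                  | _ => fun _ => 0
                  end%N).

Definition mx_output N (C : 'M[nat]_N) : set state :=
  [set s | forall i j : 'I_N, arr s 2 (i * N + j)%N = C i j].

(* Two N x N matrices of words whose product again consists of words can be
   multiplied in (worst-case, error-free) time O(N^omega). *)
Definition mm_in_time (R : realType) (omega : R) : Prop :=
  exists (al : algorithm) (c : R),
    forall (N W : nat) (A B : 'M[nat]_N),
      (0 < N)%N -> word_ok al N W ->
      (forall i j, [/\ A i j < W, B i j < W & (A *m B)%R i j < W]%N) ->
      exists t : nat,
        t%:R <= c * N%:R `^ omega /\
        prob_within R W (mx_output (A *m B)) t
          ([:: prog al], mx_input A B) = 1.

(** * Triangle problems *)

(* Random access to the adjacency matrix and to the adjacency lists: variable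
   0 holds [n]; array 0 holds the adjacency matrix, row by row; cell [u] of
   array 1 holds the degree of [u]; cell [u * n + i] of array 2 holds the i-th
   neighbour of [u]; all other cells are 0. *)
Definition graph_input n (G : sgraph n) : state :=
  let nbrs (u : nat) : seq nat :=
    if insub u is Some u' then [seq val v | v <- enum (G u')] else [::] in
  State (fun x => if x == 0%N then n else 0%N)
        (fun a k => match a with
                    | 0 => (k %% n \in nbrs (k %/ n)) : nat
                    | 1 => size (nbrs k)
                    | 2 => nth 0 (nbrs (k %/ n)) (k %% n)
                    | _ => 0
                    end%N).

(* The estimate is returned in variable 0. *)
Definition estimate_ok (R : realType) (eps : R) n (G : sgraph n) : set state :=
  [set s | (1 - eps) * (nb_triangles G)%:R <= (var s 0)%:R
           <= (1 + eps) * (nb_triangles G)%:R].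

(* The triangle is returned in variables 0, 1 and 2. *)
Definition triangle_ok n (G : sgraph n) : set state :=
  [set s | exists u v w : 'I_n,
     [/\ var s 0 = u, var s 1 = v, var s 2 = w &
         is_triangle G [set u; v; w]]].

Definition graph_class := forall n : nat, sgraph n -> Prop.

(* The hypotheses m = Omega(n^(1 + 3.82 delta)) and t = Omega(m^(1 + delta)),
   with hidden constants [c1] and [c2] *)
Definition dense_class (R : realType) (delta c1 c2 : R) : graph_class :=
  fun n G =>
    c1 * n%:R `^ (1 + 382 / 100 * delta) <= (nb_edges G)%:R /\
    c2 * (nb_edges G)%:R `^ (1 + delta) <= (nb_triangles G)%:R.

(* The probability of a correct output tends to 1 as n tends to infinity,
   uniformly over the n-vertex graphs of the class. *)
Definition whp (R : realType) (al : algorithm) (cl : graph_class)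
    (Q : forall n, sgraph n -> set state) : Prop :=
  forall eta : R, 0 < eta ->
    exists n0 : nat, forall (n : nat) (G : sgraph n) (W : nat),
      (n0 <= n)%N -> cl n G -> word_ok al n W ->
      1 - eta <= success_prob R W (Q n G) (prog al) (graph_input G).

(* Expected time at most [C * B n m] on the graphs of the class with n >= n0
   vertices and m edges *)
Definition time_le (R : realType) (al : algorithm) (cl : graph_class)
    (n0 : nat) (C : R) (B : nat -> nat -> R) : Prop :=
  forall (n : nat) (G : sgraph n) (W : nat),
    (n0 <= n)%N -> cl n G -> word_ok al n W ->
    (expected_time R W (prog al) (graph_input G)
       <= (C * B n (nb_edges G))%:E)%E.

Definition vertex_bound (R : realType) (omega delta : R) (n m : nat) : R :=
  n%:R `^ (omega * (1 - delta)).

Definition edge_bound (R : realType) (omega delta : R) (n m : nat) : R :=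
  (m%:R * n%:R `^ (- (2 * delta))) `^ (2 * omega / (omega + 1)).

(* Main.v *)
Require Import Defs.
From mathcomp Require Import zify ring lra.
Import Order.TTheory GRing.Theory Num.Theory.
Local Open Scope ring_scope.

Set Implicit Arguments.
Unset Strict Implicit.
Unset Printing Implicit Defensive.

(** The bounds to be met are superlinear in [n], so linear-time wedge sampling
    suffices and matrix multiplication enters only through [2 <= omega]: each
    step writes one cell, and the product has N^2 cells.

    Let M be the degree sum.  At every vertex u draw s_u = d_u n / M + 1
    independent pairs of neighbours of u and, for every pair that is adjacent,
    add w_u = d_u^2 / s_u to a counter X.  Since the s_u sum up to at most 2n,
    this takes O(n) steps and rounding changes the mean of X, ideally 6t, by at
    most 2n = o(t).  As w_u <= M, the variance of X is at most M * 6t <= 12mt,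
    which is o(t^2) because t = Omega(m^(1 + delta)).  Chebyshev's inequality is
    carried through the program as a loop invariant: the failure probability
    from a state with counter X is at most
    ((X + remaining mean - total mean)^2 + remaining variance) / D. *)

(** * Bounds on runs of randomized programs *)

Section Average.
Variables (R : realType) (T : Type).
Implicit Types (f g : T -> R) (l : seq T).

Lemma average1 f x : average f [:: x] = f x.
Proof. by rewrite /average big_seq1 divr1. Qed.

Lemma average_map (U : Type) (h : U -> T) f (l : seq U) :
  average f (map h l) = average (f \o h) l.
Proof. by rewrite /average big_map size_map. Qed.

Lemma le_average f g l : (forall x, f x <= g x) -> average f l <= average g l.
Proof. by move=> fg; rewrite ler_wpM2r ?invr_ge0 ?ler0n// ler_sum. Qed.

Lemma average_const (a : R) l : (0 < size l)%N -> average (fun=> a) l = a.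
Proof.
move=> l0; rewrite /average big_const_seq count_predT iter_addr_0 -(mulr_natr a).
by rewrite mulfK// pnatr_eq0 -lt0n.
Qed.

Lemma average_affine (a b : R) f l : (0 < size l)%N ->
  average (fun x => a + b * f x) l = a + b * average f l.
Proof.
move=> l0; rewrite -[in RHS](average_const a l0) /average.
by rewrite big_split/= -mulr_sumr mulrDl mulrA.
Qed.

Lemma average_ge0 f l : (forall x, 0 <= f x) -> 0 <= average f l.
Proof. by move=> f0; rewrite divr_ge0 ?sumr_ge0. Qed.

End Average.

Lemma size_step W c K s : (0 < size (step W c K s))%N.
Proof. by case: c => //= x e; rewrite size_map size_iota leq_max. Qed.

Section Semantics.
Variables (R : realType) (W : nat).
Implicit Types (Q : set state) (r : R) (T : nat).

Lemma prob_withinS Q t c K s :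
  prob_within R W Q t.+1 (c :: K, s) =
  average (prob_within R W Q t) (step W c K s).
Proof. by []. Qed.

Lemma trunc_timeS t c K s :
  trunc_time R W t.+1 (c :: K, s) = 1 + average (trunc_time R W t) (step W c K s).
Proof. by []. Qed.

Lemma prob_within_nil Q t s :
  prob_within R W Q t ([::], s) = \1_Q s.
Proof. by case: t. Qed.

Lemma prob_within_ge0 Q t k : 0 <= prob_within R W Q t k.
Proof.
elim: t k => [|t IH] [[|c K] s] //=; rewrite ?indicE ?ler0n//.
exact: average_ge0.
Qed.

Lemma prob_within_le1 Q t k : prob_within R W Q t k <= 1.
Proof.
elim: t k => [|t IH] [[|c K] s] //=; rewrite ?indicE ?lern1 ?leq_b1//.
by rewrite -[leRHS](average_const 1 (size_step W c K s)); apply: le_average.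
Qed.

Lemma prob_within_leS Q t k :
  prob_within R W Q t k <= prob_within R W Q t.+1 k.
Proof.
elim: t k => [|t IH] [[|c K] s] //.
  by rewrite /= average_ge0// => k; exact: (prob_within_ge0 Q 0).
by rewrite !prob_withinS; apply: le_average.
Qed.

Lemma le_prob_within Q t t' k : (t <= t')%N ->
  prob_within R W Q t k <= prob_within R W Q t' k.
Proof.
move=> /subnK <-; elim: (t' - t)%N => // d; rewrite addSn => /le_trans; apply.
exact: prob_within_leS.
Qed.

Lemma le_success_prob Q t p s :
  prob_within R W Q t ([:: p], s) <= success_prob R W Q p s.
Proof.
apply: ub_le_sup; last by exists t.
by exists 1 => _ [i _ <-]; apply: prob_within_le1.
Qed.

(** [r] bounds the probability of not halting in [Q] within [T] steps, and may exceed 1. The same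
    [T] caps every truncated expectation, hence the expected time. *)
Definition bounded_run (Q : set state) (T : nat) (r : R) (k : config) : Prop :=
  1 - r <= prob_within R W Q T k /\
  forall t, trunc_time R W t k <= T%:R.

Lemma bounded_run_weaken Q T T' r r' k : (T <= T')%N -> r <= r' ->
  bounded_run Q T r k -> bounded_run Q T' r' k.
Proof.
move=> TT' rr' [pr tm]; split=> [|t].
  by apply: le_trans (le_prob_within _ _ TT'); apply: le_trans pr; lra.
by apply: le_trans (tm t) _; rewrite ler_nat.
Qed.

(** A failure bound of at least 1 claims nothing, so [Q] is owed only when [r < 1]. With [r] a
    normalised squared deviation, this is the Markov step in Chebyshev's inequality. *)
Lemma bounded_run_nil Q T r s : 0 <= r -> (r < 1 -> Q s) ->
  bounded_run Q T r ([::], s).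
Proof.
move=> r0 Qs; split=> [|[]//]; rewrite prob_within_nil indicE.
have [r1|r1] := ltP r 1; last by rewrite (le_trans _ (ler0n _ _))//; lra.
have -> : s \in Q by apply/mem_set/Qs.
by rewrite lerBlDr lerDl.
Qed.

Lemma bounded_run_step Q T r c K s k : step W c K s = [:: k] ->
  bounded_run Q T r k -> bounded_run Q T.+1 r (c :: K, s).
Proof.
move=> stepE [pr tm]; split=> [|[|t]//]; first by rewrite prob_withinS stepE average1.
by rewrite trunc_timeS stepE average1 -natr1 addrC lerD2r.
Qed.

(** Law of total probability: the failure bounds of the branches are averaged over the draw, while
    one [T] serves all branches. *)
Lemma bounded_run_rand Q T (r : nat -> R) x e K s :
  let l := iota 0 (maxn 1 (eval W s e)) in
  (forall v, (v < maxn 1 (eval W s e))%N ->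
     bounded_run Q T (r v) (K, set_var s x v)) ->
  bounded_run Q T.+1 (average r l) (Rand x e :: K, s).
Proof.
move=> l run; set d := maxn 1 _ in l run *.
have l0 : (0 < size l)%N by rewrite size_iota leq_max.
have le_avg (f g : nat -> R) : (forall v, (v < d)%N -> f v <= g v) ->
    average f l <= average g l.
  move=> fg; rewrite ler_wpM2r ?invr_ge0 ?ler0n// big_seq [leRHS]big_seq.
  by apply: ler_sum => v; rewrite mem_iota add0n => /fg.
split=> [|[|t]//].
  rewrite prob_withinS /= average_map -/d -/l.
  have := average_affine 1 (-1) r l0; rewrite mulN1r => <-.
  by apply: le_avg => v /run[/= pr _]; rewrite mulN1r.
rewrite trunc_timeS /= average_map -/d -/l -natr1 addrC lerD2r.
rewrite -[leRHS](average_const T%:R l0).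
by apply: le_avg => v /run[_ /=].
Qed.

Lemma expected_time_le Q T r p s : bounded_run Q T r ([:: p], s) ->
  (expected_time R W p s <= T%:R%:E)%E.
Proof.
by move=> [_ tm]; apply: ge_ereal_sup => _ [t _ <-]; rewrite lee_fin.
Qed.

Lemma success_prob_ge Q T r p s : bounded_run Q T r ([:: p], s) ->
  1 - r <= success_prob R W Q p s.
Proof. by move=> [pr _]; apply: le_trans pr (le_success_prob _ _ _ _). Qed.

End Semantics.

Ltac exec_step := eapply bounded_run_step; [reflexivity|].

(** * Lower bound on the exponent of matrix multiplication *)

(** A potential for the lower bound: it is 0 on the input and must reach [P] when the product has
    [P] nonzero entries. *)
Definition output_cells (P : nat) (s : state) : nat :=
  \sum_(i < P) (arr s 2 i != 0%N).

(** Only [Store] changes an array, and it writes a single cell. *)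
Lemma output_cells_step W c K s k P : List.In k (step W c K s) ->
  (output_cells P k.2 <= (output_cells P s).+1)%N.
Proof.
have leS s' : arr s' = arr s -> (output_cells P s' <= (output_cells P s).+1)%N.
  by rewrite /output_cells => ->.
case: c => /=; try by move=> *; intuition; subst; apply: leS.
- move=> a e1 e2 [<- /=|//]; rewrite /output_cells /=.
  set i0 := eval W s e1; set v := eval W s e2.
  have [lti|lei] := ltnP i0 P.
    rewrite (bigD1 (Ordinal lti))//= [X in (_ <= X.+1)%N](bigD1 (Ordinal lti))//=.
    set S1 := (\sum_(i < P | _) _)%N; set S2 := (\sum_(i < P | _) _)%N.
    suff -> : S1 = S2 by case: ((if _ then _ else _) != 0)%N; lia.
    apply: eq_bigr => i /negbTE ne.
    suff -> : (i == i0 :> nat) = false by rewrite andbF.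
    by move: ne; rewrite -val_eqE /=.
  apply: leqW; rewrite leq_eqVlt; apply/orP; left; apply/eqP.
  apply: eq_bigr => i _.
  suff -> : (i == i0 :> nat) = false by rewrite andbF.
  by apply/negbTE; rewrite neq_ltn (leq_trans (ltn_ord i)).
- move=> x e /List.in_map_iff[v [<- _]]; exact: leS.
Qed.

Lemma average_eq0 (R : realType) (T : Type) (f : T -> R) (l : seq T) :
  (forall x, List.In x l -> f x = 0) -> average f l = 0.
Proof.
move=> f0; rewrite /average; suff -> : \sum_(x <- l) f x = 0 by rewrite mul0r.
elim: l f0 => [|x l IH] f0; first by rewrite big_nil.
by rewrite big_cons f0 ?IH ?addr0//=; [move=> y ly; apply: f0; right|left].
Qed.

Lemma prob_within_few_steps (R : realType) W (Q : set state) P t k :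
  (forall s, Q s -> output_cells P s = P) ->
  (output_cells P k.2 + t < P)%N -> prob_within R W Q t k = 0.
Proof.
move=> QP; elim: t k => [|t IH] [[|c K] s] //= lt.
- by rewrite indicE memNset// => /QP sP; move: lt; rewrite sP; lia.
- by rewrite indicE memNset// => /QP sP; move: lt; rewrite sP; lia.
- apply: average_eq0 => k /(output_cells_step P) le; apply: IH; lia.
Qed.

Lemma mm_steps_ge (R : realType) (al : algorithm) (c omega : R) :
  (forall (N W : nat) (A B : 'M[nat]_N),
      (0 < N)%N -> word_ok al N W ->
      (forall i j, [/\ A i j < W, B i j < W & (A *m B)%R i j < W]%N) ->
      exists t : nat,
        t%:R <= c * N%:R `^ omega /\
        prob_within R W (mx_output (A *m B)) t
          ([:: prog al], mx_input A B) = 1) ->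
  forall N, (0 < N)%N -> N%:R ^+ 2 <= c * N%:R `^ omega.
Proof.
move=> mm N N0.
(* The all-ones matrix is a hard instance: every entry of its square is [N], hence nonzero. *)
pose J : 'M[nat]_N := const_mx 1%N.
have JJ i j : (J *m J) i j = N.
  rewrite mxE (eq_bigr (fun=> 1%N)) => [|k _]; last by rewrite !mxE.
  by rewrite sumr_const card_ord -[RHS]natn.
(* The extra factor [N + 2] makes [N] a word even when [wexp al = 0]. *)
pose W := ((N + 2) ^ (wexp al).+1)%N.
have NW : (N + 2 <= W)%N by rewrite -[X in (X <= _)%N]expn1 leq_exp2l//; lia.
have [||t [tle]] := mm N W J J N0.
- by rewrite /word_ok leq_exp2l//; lia.
- by move=> i j; rewrite JJ !mxE; split; lia.
move=> pr; apply: le_trans tle; rewrite -natrX ler_nat leqNgt; apply/negP => lt.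
have := @prob_within_few_steps R W (mx_output (J *m J)) (N ^ 2) t
  ([:: prog al], mx_input J J).
rewrite pr => H; suff /eqP : (1 : R) = 0 by rewrite oner_eq0.
apply: H => [s Qs|].
  rewrite /output_cells (eq_bigr (fun=> 1%N)) ?sum1_card ?card_ord// => -[i /= lti] _.
  rewrite (divn_eq i N).
  have iN : (i %/ N < N)%N by rewrite ltn_divLR.
  have := Qs (Ordinal iN) (Ordinal (ltn_pmod i N0)); rewrite JJ /= => ->.
  by rewrite -lt0n N0.
by rewrite /output_cells big1// => i _.
Qed.

(** For [omega < 2], writing [N ^ 2] cells would force [N ^ (2 - omega) <= c] for all [N], which
    fails once [N] exceeds [c ^ (1 / (2 - omega))]. *)
Lemma mm_exponent_ge2 (R : realType) (omega : R) :
  mm_in_time omega -> 2 <= omega.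
Proof.
move=> [al [c /mm_steps_ge mm]]; rewrite leNgt; apply/negP => lt2.
pose a := 2 - omega; have a0 : 0 < a by rewrite subr_gt0.
have bnd N : (0 < N)%N -> N%:R `^ a <= c.
  move=> N0; have Nr : 0 < N%:R :> R by rewrite ltr0n.
  have := mm _ N0; rewrite -powR_mulrn ?ler0n//.
  have -> : (2%:R : R) = a + omega by rewrite /a subrK.
  rewrite powRD; last by apply/implyP => _; rewrite gt_eqF.
  by rewrite ler_pM2r ?powR_gt0.
have c1 : 1 <= c by have := bnd 1%N isT; rewrite powR1.
pose N := (Num.truncn (c `^ a^-1)).+1.
have := bnd N isT; apply/negP; rewrite -ltNge.
have -> : c = (c `^ a^-1) `^ a by rewrite -powRrM mulVf ?gt_eqF// powRr1//; lra.
by rewrite gt0_ltr_powR ?nnegrE ?powR_ge0// ?truncnS_gt.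
Qed.

(** * Counting wedges and triangles *)

Lemma card_set3_neq (T : finType) (a b c : T) : #|[set a; b; c]| = 3%N ->
  [/\ a != b, a != c & b != c].
Proof.
have le2 (x y : T) : #|[set x; y]| != 3%N by rewrite cards2; case: (x != y).
move=> c3; split; apply: contra_eq_neq c3 => ->; first by rewrite finset.setUid.
- by rewrite -finset.setUA (finset.setUC [set b]) finset.setUA finset.setUid.
- by rewrite -finset.setUA finset.setUid.
Qed.

(** The triples with underlying set [S] are its 3! orderings, listed in [l]. *)
Lemma card_fiber_set3 (T : finType) (S : {set T}) : #|S| = 3%N ->
  #|[set p : T * T * T | [set p.1.1; p.1.2; p.2] == S]| = 6%N.
Proof.
move=> S3; have : size (enum S) = 3%N by rewrite -cardE.
case E : (enum S) => [|x [|y [|z [|//]]]] // _.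
have := enum_uniq S; rewrite E /= !inE andbT negb_or => /andP[/andP[xy xz] yz].
have memS w : (w \in S) = [|| w == x, w == y | w == z] by rewrite -mem_enum E !inE.
pose l := [:: (x,y,z); (x,z,y); (y,x,z); (y,z,x); (z,x,y); (z,y,x)].
have ul : uniq l.
  rewrite /l /= !inE !xpair_eqE !eqxx /=.
  by rewrite ?(eq_sym y x) ?(eq_sym z x) ?(eq_sym z y)
    ?(negbTE xy) ?(negbTE xz) ?(negbTE yz) /= ?andbF.
rewrite -[6%N]/(size l) -(card_uniqP ul); apply: eq_card => -[[a b] c].
rewrite !inE /=; apply/idP/idP => [/eqP eS|].
  have card3 : #|[set a; b; c]| = 3%N by rewrite eS.
  have [nab nac nbc] := card_set3_neq card3.
  have : a \in S by rewrite -eS !inE eqxx.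
  have : b \in S by rewrite -eS !inE eqxx orbT.
  have : c \in S by rewrite -eS !inE eqxx !orbT.
  rewrite !memS => /or3P[]/eqP ? /or3P[]/eqP ? /or3P[]/eqP ?; subst;
    by move: nab nac nbc; rewrite !xpair_eqE ?eqxx ?andbT ?orbT.
rewrite !xpair_eqE => H; apply/eqP/finset.setP => w; rewrite memS !inE.
by move: H; do 5?[case/orP]; case/andP => /andP[/eqP-> /eqP->] /eqP->;
  do 3!case: eqP.
Qed.

Section Graph.
Variables (n : nat) (G : sgraph n).

Lemma is_triangle3 u v w :
  is_triangle G [set u; v; w] = [&& G u v, G u w & G v w].
Proof.
apply/andP/and3P => [[/eqP c3 /forall_inP H]|[uv uw vw]].
  have [nuv nuw nvw] := card_set3_neq c3.
  have H2 x y : x \in [set u; v; w] -> y \in [set u; v; w] -> x != y -> G x y.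
    by move=> /H/forall_inP /(_ y) Hy /Hy/implyP.
  by split; apply: H2 => //; rewrite !inE eqxx ?orbT.
have neq x y : G x y -> x != y by apply: contraTneq => ->; rewrite adj_irr.
split.
  rewrite -finset.setUA cardsU1 !inE negb_or (neq _ _ uv) (neq _ _ uw) cards2.
  by rewrite (neq _ _ vw).
apply/forall_inP => x; rewrite !inE => Hx; apply/forall_inP => y; rewrite !inE => Hy.
apply/implyP; move: Hx Hy => /orP[/orP[]|]/eqP-> /orP[/orP[]|]/eqP->;
  by rewrite ?eqxx// => _; rewrite // adj_sym.
Qed.

(** Double counting of ordered triples of pairwise adjacent vertices: grouped by first vertex on the
    left, by underlying set with 6 orderings each on the right. *)
Lemma sum_closed_wedges :
  (\sum_(u < n) \sum_(v in G u) \sum_(w in G u) G v w = 6 * nb_triangles G)%N.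
Proof.
transitivity (\sum_(p : 'I_n * 'I_n * 'I_n)
    (is_triangle G [set p.1.1; p.1.2; p.2] : nat))%N.
  under [in RHS]eq_bigr => p _ do rewrite is_triangle3.
  rewrite -(pair_bigA _ (fun p w => ([&& G p.1 p.2, G p.1 w & G p.2 w] : nat)))/=.
  rewrite -(pair_bigA _ (fun u v => (\sum_w [&& G u v, G u w & G v w])%N))/=.
  have inG u v : (v \in G u) = G u v by [].
  apply: eq_bigr => u _; rewrite big_mkcond; apply: eq_bigr => v _; rewrite inG.
  case: (G u v); last by rewrite big1.
  by rewrite big_mkcond; apply: eq_bigr => w _; rewrite inG; case: (G u w).
rewrite -big_mkcond/= (partition_big (fun p => [set p.1.1; p.1.2; p.2])
  (fun S => is_triangle G S))//=.
rewrite (eq_bigr (fun=> 6%N)) => [|S SG].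
  by rewrite sum_nat_const mulnC /nb_triangles cardsE.
have /andP[/eqP S3 _] := SG.
rewrite -(card_fiber_set3 S3) -sum1_card; apply: eq_bigl => p; rewrite inE.
by case: eqP => [->|]; rewrite ?SG ?andbF.
Qed.

(** Every ordered adjacent pair spans an edge, and an edge is spanned by at most two such pairs. *)
Lemma sum_degree_le : (\sum_(u < n) #|G u| <= 2 * nb_edges G)%N.
Proof.
rewrite (eq_bigr (fun u => \sum_v (G u v : nat))%N) => [|u _]; last first.
  by rewrite -sum1_card big_mkcond.
rewrite pair_bigA/= -big_mkcond/=.
rewrite (partition_big (fun p => [set p.1; p.2]) (fun E => E \in edges G))/=; last first.
  move=> [u v] /= uv; rewrite inE.
  by apply/existsP; exists u; apply/existsP; exists v; rewrite eqxx.
rewrite mulnC -sum_nat_const; apply: leq_sum => E; rewrite inE.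
move=> /existsP[u /existsP[v /andP[/eqP-> uv]]].
apply: leq_trans (_ : (#|[set (u, v); (v, u)]| <= 2)%N); last by rewrite cards2; case: eqP.
rewrite sum1_card subset_leq_card//; apply/fintype.subsetP => -[a b].
rewrite !inE /= unfold_in /= => /andP[ab /eqP eE].
have nab : a != b by apply: contraTneq ab => ->; rewrite adj_irr.
have : a \in [set u; v] by rewrite -eE !inE eqxx.
have : b \in [set u; v] by rewrite -eE !inE eqxx orbT.
rewrite !inE => /orP[]/eqP eb /orP[]/eqP ea; move: nab;
  by rewrite eb ea ?eqxx ?orbT.
Qed.

End Graph.

(** * Wedge sampling *)

(* Variables: 0 is n, 1 the current vertex u, 2 the number of samples still to
   be drawn at u, 3 the degree sum, 4 and 5 the sampled neighbours, 6 the
   accumulated weight, 7 to 9 the last triangle found. *)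
Definition degree_expr : expr := Get 1 (Var 1).

Definition samples_expr : expr :=
  Bin Add (Bin Div (Bin Mul degree_expr (Var 0)) (Var 3)) (Const 1).

Definition weight_expr : expr :=
  Bin Div (Bin Mul degree_expr degree_expr) samples_expr.

Definition neighbour_expr (x : nat) : expr :=
  Get 2 (Bin Add (Bin Mul (Var 1) (Var 0)) (Var x)).

Definition record_hit : cmd :=
  Seq (Assign 6 (Bin Add (Var 6) weight_expr))
 (Seq (Assign 7 (Var 1)) (Seq (Assign 8 (Var 4)) (Assign 9 (Var 5)))).

(** Variables 4 and 5 first receive positions in the neighbour list of the current vertex and are
    then overwritten by the neighbours found there. *)
Definition sample : cmd :=
  Seq (Rand 4 degree_expr)
 (Seq (Rand 5 degree_expr)
 (Seq (Assign 4 (neighbour_expr 4))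
 (Seq (Assign 5 (neighbour_expr 5))
 (Seq (If (Get 0 (Bin Add (Bin Mul (Var 4) (Var 0)) (Var 5))) record_hit Skip)
      (Assign 2 (Bin Sub (Var 2) (Const 1))))))).

Definition next_vertex : cmd := Assign 1 (Bin Add (Var 1) (Const 1)).

Definition sum_degrees : cmd :=
  While (Bin Lt (Var 1) (Var 0))
    (Seq (Assign 3 (Bin Add (Var 3) degree_expr)) next_vertex).

Definition sample_vertices : cmd :=
  While (Bin Lt (Var 1) (Var 0))
    (Seq (Assign 2 samples_expr) (Seq (While (Var 2) sample) next_vertex)).

(** The command [c] reads off the result: the estimator and the finder share the sampling and differ
    only in [c]. *)
Definition wedge_sampling (c : cmd) : cmd :=
  Seq sum_degrees (Seq (Assign 1 (Const 0)) (Seq sample_vertices c)).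

Section WedgeSampling.
Variables (R : realType) (W n : nat) (A : nat -> nat -> nat).
(** Stands for forming a triangle. It is kept abstract so that the loops are analysed without
    reference to graphs. *)
Variable Tri : nat -> nat -> nat -> Prop.

Definition degree_sum : nat := (\sum_(0 <= u < n) A 1 u)%N.
Definition nsamples (u : nat) : nat := (A 1 u * n %/ degree_sum + 1)%N.
Definition weight (u : nat) : nat := (A 1 u * A 1 u %/ nsamples u)%N.
Definition hit (u a b : nat) : nat :=
  A 0 (A 2 (u * n + a) * n + A 2 (u * n + b))%N.
(* [Rand] draws 0 at an isolated vertex, hence the [maxn 1]. *)
Definition hit_prob (u : nat) : R :=
  let l := iota 0 (maxn 1 (A 1 u)) in
  average (fun a => average (fun b => (hit u a b)%:R) l) l.
Definition mean_from (u : nat) : R :=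
  \sum_(u <= i < n) (nsamples i)%:R * (weight i)%:R * hit_prob i.
(** Each sample is charged its second moment [w ^ 2 * p], an upper bound for its variance
    [w ^ 2 * p * (1 - p)]. *)
Definition variance_from (u : nat) : R :=
  \sum_(u <= i < n) (nsamples i)%:R * (weight i)%:R ^+ 2 * hit_prob i.

Hypothesis n_gt0 : (0 < n)%N.
Hypothesis W_large : ((n + 2) ^ 3 <= W)%N.
Hypothesis degree_le : forall u, (A 1 u <= n)%N.
Hypothesis neighbour_lt : forall k, (A 2 k < n)%N.
Hypothesis adjacency_le1 : forall k, (A 0 k <= 1)%N.
Hypothesis hit_triangle : forall u a b, (u < n)%N ->
  (a < maxn 1 (A 1 u))%N -> (b < maxn 1 (A 1 u))%N -> hit u a b != 0%N ->
  Tri u (A 2 (u * n + a)%N) (A 2 (u * n + b)%N).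

Lemma cube_lt : (n ^ 3 + n ^ 2 + n + 2 < W)%N.
Proof. by move: W_large; nia. Qed.

(** Addresses and degree products are of order [n ^ 2] and the counter is at most [n ^ 3], so
    reduction modulo [W] never alters a computed value. *)
Lemma mod_word k : (k <= n ^ 3 + n ^ 2 + n + 2)%N -> (k %% W)%N = k.
Proof. by move=> kle; rewrite modn_small// (leq_ltn_trans kle cube_lt). Qed.

Lemma degree_sum_le : (degree_sum <= n ^ 2)%N.
Proof.
rewrite /degree_sum big_mkord; apply: (@leq_trans (\sum_(u < n) n)%N).
  exact: leq_sum.
by rewrite sum_nat_const card_ord expnS expn1.
Qed.

Lemma degree_mul_le u k : (k <= n)%N -> (A 1 u * k <= n ^ 2)%N.
Proof. by move=> kn; rewrite expnS expn1 leq_mul. Qed.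

Lemma nsamples_weight_le u : (nsamples u * weight u <= n ^ 2)%N.
Proof.
rewrite mulnC; apply: leq_trans (leq_divM _ _) _; exact: degree_mul_le.
Qed.

(** The degrees sum to [degree_sum], so the quotients contribute at most [n]; the added ones
    contribute another [n]. *)
Lemma sum_nsamples_le : (\sum_(0 <= u < n) nsamples u <= 2 * n)%N.
Proof.
rewrite /nsamples big_split/= sum_nat_const_nat subn0 muln1 mul2n -addnn leq_add2r.
(* Without edges the quotients are divisions by 0, which yield 0. *)
have [->|M0] := posnP degree_sum.
  by rewrite big1// => i _; rewrite divn0.
rewrite -(leq_pmul2r M0) big_distrl/=.
apply: (@leq_trans (\sum_(0 <= u < n) A 1 u * n)%N).
  by apply: leq_sum => u _; apply: leq_divM.
by rewrite -big_distrl/= mulnC.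
Qed.

(** The counter doubles as a flag: when it is positive some sample was a hit, so variables 7 to 9
    hold a triangle. *)
Record loop_inv (u : nat) (s : state) : Prop := LoopInv {
  inv_arr : arr s = A;
  inv_n : var s 0 = n;
  inv_u : var s 1 = u;
  inv_M : var s 3 = degree_sum;
  inv_tri : (0 < var s 6)%N -> Tri (var s 7) (var s 8) (var s 9) }.

(** * Execution of the sampling loops *)

Lemma eval_degree u s : arr s = A -> var s 1 = u ->
  eval W s degree_expr = A 1 u.
Proof. by move=> /= -> ->. Qed.

Lemma eval_samples u s : loop_inv u s -> eval W s samples_expr = nsamples u.
Proof.
move=> [sA s0 s1 s3 _]; rewrite /= sA s0 s1 s3.
have dn := degree_mul_le u (leqnn n).
rewrite (@mod_word (_ * _))%N; last lia.
rewrite [(1 %% W)%N]mod_word; last lia.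
have := leq_div (A 1 u * n)%N degree_sum.
by move=> dle; rewrite !mod_word//; lia.
Qed.

Lemma eval_weight u s : loop_inv u s -> eval W s weight_expr = weight u.
Proof.
move=> Is; rewrite [LHS]/= -/samples_expr -/(eval W s samples_expr).
rewrite -[X in (_ %/ X)%N]/(eval W s samples_expr) (eval_samples Is).
have [sA s0 s1 s3 _] := Is; rewrite sA s1.
have dd := degree_mul_le u (degree_le u).
rewrite (@mod_word (A 1 u * _))%N; last lia.
by rewrite mod_word// (leq_trans (leq_div _ _))//; lia.
Qed.

Lemma eval_neighbour x u s : arr s = A -> var s 0 = n -> var s 1 = u ->
  (u < n)%N -> (var s x < n)%N ->
  eval W s (neighbour_expr x) = A 2 (u * n + var s x)%N.
Proof.
move=> sA s0 s1 un xn; rewrite /= sA s0 s1.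
have unn : (u * n <= n ^ 2)%N by rewrite expnS expn1 leq_mul// ltnW.
by rewrite !mod_word//; lia.
Qed.

(** [r h] is the failure bound after a sample with outcome [h]; their mean is the linear
    interpolation at [hit_prob u]. The constant 18 counts the steps of a sample that hits. *)
Lemma sample_run Q K T (r : nat -> R) u j s :
  loop_inv u s -> (u < n)%N -> var s 2 = j.+1 -> (j.+1 <= n ^ 2 + 1)%N ->
  (var s 6 + weight u <= n ^ 3)%N ->
  (forall h s', (h <= 1)%N -> loop_inv u s' -> var s' 2 = j ->
     var s' 6 = (var s 6 + h * weight u)%N -> bounded_run W Q T (r h) (K, s')) ->
  bounded_run W Q (18 + T) (r 0%N + (r 1%N - r 0%N) * hit_prob u)
    (sample :: K, s).
Proof.
move=> Is un s2 jle s6 next; rewrite !addSn add0n.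
have [sA s0 s1 s3 s9] := Is.
have l0 : (0 < size (iota 0 (maxn 1 (A 1 u))))%N by rewrite size_iota leq_max.
have dmax : (maxn 1 (A 1 u) <= n)%N by rewrite geq_max n_gt0 degree_le.
(* As [hit] is 0 or 1, [r] of it equals an affine function of it, and affine functions commute with
   averages. *)
have av : r 0%N + (r 1%N - r 0%N) * hit_prob u =
    average (fun a => average (fun b => r (hit u a b)) (iota 0 (maxn 1 (A 1 u))))
       (iota 0 (maxn 1 (A 1 u))).
  rewrite /hit_prob /= -average_affine//; congr average; apply: funext => a.
  rewrite -average_affine//; congr average; apply: funext => b.
  have := adjacency_le1 (A 2 (u * n + a) * n + A 2 (u * n + b))%N.
  by rewrite -/(hit u a b); case: (hit u a b) => [|[|//]] _; rewrite ?mulr0 ?mulr1; ring.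
rewrite av; exec_step.
have dE s' : arr s' = A -> var s' 1 = u -> eval W s' degree_expr = A 1 u by exact: eval_degree.
rewrite -{2}(dE s)//; apply: bounded_run_rand => a; rewrite (dE s)// => alt.
exec_step; set sa := set_var s 4 a.
rewrite -(dE sa)//; apply: bounded_run_rand => b; rewrite (dE sa)// => blt.
exec_step; set sb := set_var sa 5 b.
exec_step; rewrite (@eval_neighbour 4 u sb)//; last by apply: leq_trans alt dmax.
set a' := A 2 _; set sc := set_var sb 4 a'.
exec_step; exec_step; rewrite (@eval_neighbour 5 u sc)//; last by apply: leq_trans blt dmax.
set b' := A 2 _; set sd := set_var sc 5 b'.
exec_step; exec_step.
have a'n : (a' < n)%N by apply: neighbour_lt.
have b'n : (b' < n)%N by apply: neighbour_lt.
have -> : eval W sd (Get 0 (Bin Add (Bin Mul (Var 4) (Var 0)) (Var 5))) = hit u a b.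
  rewrite /= sA s0.
  have unn : (a' * n <= n ^ 2)%N by rewrite expnS expn1 leq_mul// ltnW.
  by rewrite !mod_word//; lia.
have Isd : loop_inv u sd by split.
have hle : (hit u a b <= 1)%N by apply: adjacency_le1.
have [h0|h0] := eqVneq (hit u a b) 0%N; last first.
  have h1 : hit u a b = 1%N by lia.
  have e6 : eval W sd (Bin Add (Var 6) weight_expr) = (var s 6 + weight u)%N.
    rewrite -[LHS]/((var s 6 + eval W sd weight_expr) %% W)%N.
    by rewrite (eval_weight Isd) mod_word//; lia.
  exec_step; exec_step; rewrite e6; do 6 exec_step; apply: next => //.
  - split => //= _; rewrite s1; exact: hit_triangle.
  - rewrite /= s2 !mod_word//; nia.
  - by rewrite /= h1 mul1n.
(* A miss skips the recording and takes fewer steps. *)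
apply: (@bounded_run_weaken _ _ _ (T.+2) _ (r (hit u a b))) => //; first lia.
exec_step; exec_step; apply: next => //.
- by rewrite /= s2 !mod_word//; lia.
- by rewrite /= h0 mul0n addn0.
Qed.

(** The Chebyshev invariant at one vertex: [mu] is the later mean minus the total mean, [v] the
    later variance, and [cap] limits the counter to prevent overflow. Each round costs 18 steps and
    a loop test. *)
Lemma sample_loop_run Q K T (mu v Den : R) u cap : 0 < Den -> (u < n)%N ->
  (cap <= n ^ 3)%N ->
  (forall s, loop_inv u s -> (var s 6 <= cap)%N ->
     bounded_run W Q T ((((var s 6)%:R + mu) ^+ 2 + v) / Den) (K, s)) ->
  forall j s, loop_inv u s -> var s 2 = j -> (j <= n ^ 2 + 1)%N ->
    (var s 6 + j * weight u <= cap)%N ->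
  bounded_run W Q (19 * j + 1 + T)
    ((((var s 6)%:R + j%:R * (weight u)%:R * hit_prob u + mu) ^+ 2
       + j%:R * (weight u)%:R ^+ 2 * hit_prob u + v) / Den)
    (While (Var 2) sample :: K, s).
Proof.
move=> D0 un capn final; elim=> [|j IH] s Is s2 jle s6.
  rewrite muln0 add0n add1n; exec_step; rewrite /= s2.
  by rewrite !mul0r !addr0; apply: final => //; lia.
(* [y] is the predicted deviation if the current sample misses; a hit shifts it by [w]. *)
pose y : R := (var s 6)%:R + j%:R * (weight u)%:R * hit_prob u + mu.
pose w : R := (weight u)%:R.
pose rest : R := j%:R * w ^+ 2 * hit_prob u + v.
pose r (h : nat) : R := ((y + h%:R * w) ^+ 2 + rest) / Den.
have -> : (19 * j.+1 + 1 + T = (18 + (19 * j + 1 + T)).+1)%N by lia.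
exec_step; rewrite [eval _ _ _]/= s2 [_ != _]/=.
apply: (@bounded_run_weaken _ _ _ (18 + (19 * j + 1 + T)) _
  (r 0%N + (r 1%N - r 0%N) * hit_prob u)) => //.
  have -> : r 0%N + (r 1%N - r 0%N) * hit_prob u =
      (y ^+ 2 + rest + (2 * y * w + w ^+ 2) * hit_prob u) / Den.
    by rewrite /r mul0r mul1r; field; rewrite gt_eqF.
  rewrite ler_pM2r ?invr_gt0// -subr_ge0.
  set p := hit_prob u.
  (* The slack is exactly the difference between second moment and variance of one sample. *)
  rewrite [leRHS](_ : _ = (w * p) ^+ 2) ?sqr_ge0//.
  by rewrite /rest /y -/w -/p -natr1; ring.
apply: (@sample_run _ _ _ r _ j) => //.
  by apply: leq_trans capn; move: s6; rewrite mulSn; lia.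
move=> h s' hle Is' s'2 s'6.
have X' : (var s' 6 + j * weight u <= cap)%N.
  rewrite s'6 -addnA; apply: leq_trans s6; rewrite leq_add2l mulSn leq_add2r.
  by rewrite -[leqRHS]mul1n leq_mul2r hle orbT.
apply: bounded_run_weaken (IH s' Is' s'2 (ltnW jle) X') => //.
rewrite /r /rest /y s'6 natrD natrM -/w.
by rewrite ler_pM2r ?invr_gt0// le_eqVlt; apply/orP; left; apply/eqP; ring.
Qed.

Lemma nsamples_le u : (nsamples u <= n ^ 2 + 1)%N.
Proof.
by rewrite leq_add2r (leq_trans (leq_div _ _))// degree_mul_le.
Qed.

Lemma mean_from_ltn u : (u < n)%N ->
  mean_from u = (nsamples u)%:R * (weight u)%:R * hit_prob u + mean_from u.+1.
Proof. by move=> un; rewrite /mean_from big_ltn. Qed.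

Lemma variance_from_ltn u : (u < n)%N -> variance_from u =
  (nsamples u)%:R * (weight u)%:R ^+ 2 * hit_prob u + variance_from u.+1.
Proof. by move=> un; rewrite /variance_from big_ltn. Qed.

Lemma lt_expr_eval s : ((var s 1 < var s 0) = (eval W s (Bin Lt (Var 1) (Var 0)) != 0))%N.
Proof.
rewrite /= mod_word; last by case: (_ < _)%N; lia.
by case: (_ < _)%N.
Qed.

Lemma sample_vertices_run Q K T (Den : R) (mu : R) : 0 < Den ->
  (forall s, arr s = A -> (var s 6 <= n ^ 3)%N ->
     ((0 < var s 6)%N -> Tri (var s 7) (var s 8) (var s 9)) ->
     bounded_run W Q T (((var s 6)%:R + mu) ^+ 2 / Den) (K, s)) ->
  forall u s, (u <= n)%N -> loop_inv u s ->
    (var s 6 + \sum_(u <= i < n) nsamples i * weight i <= n ^ 3)%N ->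
  bounded_run W Q (\sum_(u <= i < n) (6 + 19 * nsamples i) + 1 + T)
    ((((var s 6)%:R + mean_from u + mu) ^+ 2 + variance_from u) / Den)
    (sample_vertices :: K, s).
Proof.
move=> D0 final u; move: {2}(n - u)%N (erefl (n - u)%N) => k.
elim: k u => [|k IH] u nu s un Is s6.
  have unE : u = n by lia.
  rewrite unE big_geq// add0n add1n; exec_step.
  rewrite -lt_expr_eval (inv_u Is) (inv_n Is) unE ltnn.
  rewrite /mean_from /variance_from !big_geq// !addr0.
  apply: final; [exact: inv_arr Is|lia|exact: inv_tri Is].
have ult : (u < n)%N by lia.
move: s6; rewrite big_ltn// => s6.
rewrite big_ltn//.
have -> : (6 + 19 * nsamples u + \sum_(u.+1 <= i < n) (6 + 19 * nsamples i) + 1 + T =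
  (19 * nsamples u + 1 + (\sum_(u.+1 <= i < n) (6 + 19 * nsamples i) + 1 + T).+1).+4)%N by lia.
exec_step; rewrite -lt_expr_eval (inv_u Is) (inv_n Is) ult.
exec_step; exec_step; rewrite (eval_samples Is); exec_step.
set s1 := set_var s 2 _.
have Is1 : loop_inv u s1 by case: Is.
rewrite (mean_from_ltn ult) (variance_from_ltn ult) !addrA.
rewrite -(addrA _ (mean_from u.+1)).
(* The cap is the counter reached if every sample at [u] hits; the mean and variance of the later
   vertices enter the offsets of the inner loop. *)
apply: (@sample_loop_run _ _ _ _ _ _ _
  (var s 6 + nsamples u * weight u)%N D0 ult _ _ _ s1) => //.
- by lia.
- move=> s2 Is2 s26; exec_step; rewrite !addrA; set s3 := set_var s2 1 _.
  rewrite (_ : var s2 6 = var s3 6)//.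
  apply: (IH u.+1 _ s3) => //; first by lia.
  + case: Is2 => sA s0 su sM st; split=> //=.
    by rewrite su !mod_word//; lia.
  + by rewrite /=; lia.
- exact: nsamples_le.
Qed.

(** Bounds the counter in the worst case where every sample hits, so it cannot overflow. *)
Lemma sum_nsamples_weight_le :
  (\sum_(0 <= u < n) nsamples u * weight u <= n ^ 3)%N.
Proof.
rewrite big_mkord; apply: (@leq_trans (\sum_(u < n) n ^ 2)%N).
  by apply: leq_sum => u _; apply: nsamples_weight_le.
by rewrite sum_nat_const card_ord -expnS.
Qed.

Lemma sum_degrees_run Q K T (r : R) :
  (forall s, arr s = A -> var s 0 = n -> var s 3 = degree_sum -> var s 6 = 0%N ->
     bounded_run W Q T r (K, s)) ->
  forall u s, (u <= n)%N -> arr s = A -> var s 0 = n -> var s 1 = u ->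
    var s 3 = (\sum_(0 <= i < u) A 1 i)%N -> var s 6 = 0%N ->
  bounded_run W Q (4 * (n - u) + 1 + T) r (sum_degrees :: K, s).
Proof.
move=> final u; move: {2}(n - u)%N (erefl (n - u)%N) => k.
elim: k u => [|k IH] u nu s un sA s0 s1 s3 s6.
  have unE : u = n by lia.
  rewrite nu muln0 add0n add1n; exec_step.
  rewrite -lt_expr_eval s0 s1 unE ltnn.
  by apply: final => //; rewrite s3 unE.
have ult : (u < n)%N by lia.
have -> : (4 * (n - u) + 1 + T = (4 * (n - u.+1) + 1 + T).+4)%N by lia.
exec_step; rewrite -lt_expr_eval s0 s1 ult; exec_step; exec_step; exec_step.
have le2 : (\sum_(0 <= i < u.+1) A 1 i <= n ^ 2)%N.
  apply: leq_trans degree_sum_le; rewrite /degree_sum [leqRHS](big_cat_nat (leq0n u.+1) ult)/=.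
  exact: leq_addr.
apply: IH => //; first by lia.
- by rewrite /= s1 !mod_word//; lia.
- move: le2; rewrite big_nat_recr//= sA s1 s3 => le2.
  by rewrite mod_word//; lia.
Qed.

Lemma wedge_sampling_run Q c T (Den : R) : 0 < Den ->
  (forall s, arr s = A -> (var s 6 <= n ^ 3)%N ->
     ((0 < var s 6)%N -> Tri (var s 7) (var s 8) (var s 9)) ->
     bounded_run W Q T (((var s 6)%:R - mean_from 0) ^+ 2 / Den) ([:: c], s)) ->
  bounded_run W Q (48 * n + 6 + T) (variance_from 0 / Den)
    ([:: wedge_sampling c], State (fun x => if x == 0%N then n else 0%N) A).
Proof.
move=> D0 final.
(* Summing degrees takes [4n] steps and sampling [6n + 19 * 2n], which gives [48n] up to a
   constant. *)
pose T1 := (\sum_(0 <= i < n) (6 + 19 * nsamples i) + 1 + T)%N.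
apply: (@bounded_run_weaken _ _ _ (4 * (n - 0) + 1 + T1.+3).+1 _
  (variance_from 0 / Den)) => //.
  rewrite /T1 big_split/= sum_nat_const_nat subn0 -big_distrr/=.
  by move: sum_nsamples_le; lia.
exec_step; apply: (@sum_degrees_run _ _ _ _ _ 0%N) => //=; last by rewrite big_geq.
move=> s sA s0 s3 s6; exec_step; exec_step; exec_step.
rewrite [eval _ _ _]/= mod0n; set s1 := set_var s 1 0%N.
(* At the start the predicted deviation is 0, so only the variance remains in the failure bound. *)
have -> : variance_from 0 =
    ((var s1 6)%:R + mean_from 0 + - mean_from 0) ^+ 2 + variance_from 0.
  by rewrite /= s6 add0r subrr expr0n add0r.
apply: sample_vertices_run => //.
- by split=> //=; rewrite s6.
- by rewrite /= s6 sum_nsamples_weight_le.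
Qed.

End WedgeSampling.

(** * Wedge sampling on graphs *)

Section GraphInput.
Variables (R : realType) (n : nat) (G : sgraph n).

(** Names the list local to [graph_input], so that array cells unfold to it by computation. *)
Definition neighbours (u : nat) : seq nat :=
  if insub u is Some u' then [seq val v | v <- enum (G u')] else [::].

Local Notation A := (arr (graph_input G)).

Definition triangle_at (x y z : nat) : Prop :=
  exists u v w : 'I_n, [/\ x = u, y = v, z = w & is_triangle G [set u; v; w]].

Definition closed_wedges (u : 'I_n) : nat :=
  (\sum_(v in G u) \sum_(w in G u) G v w)%N.

Lemma neighboursE (u : 'I_n) : neighbours u = [seq val v | v <- enum (G u)].
Proof. by rewrite /neighbours valK. Qed.

Lemma input_degree u : A 1 u = size (neighbours u).
Proof. by []. Qed.

Lemma input_neighbour u a : (a < n)%N -> A 2 (u * n + a)%N = nth 0%N (neighbours u) a.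
Proof.
move=> an; have n0 : (0 < n)%N by case: n an.
rewrite /= divnMDl// divn_small// addn0 modnMDl modn_small//.
Qed.

Lemma input_adjacent x y : (y < n)%N -> A 0 (x * n + y)%N = (y \in neighbours x) :> nat.
Proof.
move=> yn; have n0 : (0 < n)%N by case: n yn.
by rewrite /= divnMDl// divn_small// addn0 modnMDl modn_small.
Qed.

Lemma mem_neighbours (u v : 'I_n) : (val v \in neighbours u) = G u v.
Proof. by rewrite neighboursE mem_map ?mem_enum//; apply: val_inj. Qed.

Lemma neighboursP u x : x \in neighbours u ->
  exists u' v : 'I_n, [/\ u = u', x = v & G u' v].
Proof.
rewrite /neighbours; case: insubP => // u' _ <- /mapP[v]; rewrite mem_enum => uv ->.
by exists u', v.
Qed.

Lemma size_neighbours_le u : (size (neighbours u) <= n)%N.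
Proof.
rewrite /neighbours; case: insubP => // u' _ _.
by rewrite size_map -cardE -[leqRHS]card_ord max_card.
Qed.

Lemma neighbour_lt k : (0 < n)%N -> (A 2 k < n)%N.
Proof.
move=> n0; rewrite -[A 2 k]/(nth 0%N (neighbours (k %/ n)) (k %% n)).
have [kn|kn] := ltnP (k %% n) (size (neighbours (k %/ n))).
  by have [_ [v [_ -> _]]] := neighboursP (mem_nth 0%N kn).
by rewrite nth_default.
Qed.

Lemma neighbours_irr u : u \notin neighbours u.
Proof.
by apply/negP => /neighboursP[u' [v [-> /val_inj <-]]]; rewrite adj_irr.
Qed.

Lemma input_hit u a b : (0 < n)%N ->
  (a < maxn 1 (A 1 u))%N -> (b < maxn 1 (A 1 u))%N ->
  hit n A u a b = (nth 0%N (neighbours u) b \in neighbours (nth 0%N (neighbours u) a)).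
Proof.
move=> n0 alt blt; have dn : (maxn 1 (A 1 u) <= n)%N.
  by rewrite geq_max n0 size_neighbours_le.
rewrite /hit input_adjacent ?neighbour_lt//.
by rewrite !input_neighbour ?(leq_trans alt)// (leq_trans blt).
Qed.

Lemma input_hit_triangle u a b : (u < n)%N ->
  (a < maxn 1 (A 1 u))%N -> (b < maxn 1 (A 1 u))%N -> hit n A u a b != 0%N ->
  triangle_at u (A 2 (u * n + a)%N) (A 2 (u * n + b)%N).
Proof.
move=> un alt blt; have n0 : (0 < n)%N by case: n un.
have dn : (maxn 1 (A 1 u) <= n)%N by rewrite geq_max n0 size_neighbours_le.
rewrite input_hit// !input_neighbour ?(leq_trans alt)// ?(leq_trans blt)//.
rewrite eqb0 negbK.
(* At an isolated vertex both lookups return the default vertex 0, which is not its own neighbour,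
   so there is no hit. *)
have [d0|d0] := posnP (A 1 u).
  have -> : neighbours u = [::] by apply: size0nil.
  by rewrite !nth_nil (negbTE (neighbours_irr 0)).
move: alt blt; rewrite (maxn_idPr d0) => alt blt.
have [u1 [v [uE vE uv]]] := neighboursP (mem_nth 0%N alt).
have [u2 [w [uE' wE uw]]] := neighboursP (mem_nth 0%N blt).
rewrite vE wE mem_neighbours => vw.
have uu : u1 = u2 by apply: val_inj; rewrite /= -uE -uE'.
by exists u1, v, w; split=> //; rewrite is_triangle3 uv vw uu uw.
Qed.

(** A sample is uniform over the squared degree many ordered pairs of neighbours, of which
    [closed_wedges u] are adjacent. At an isolated vertex both sides are 0. *)
Lemma degree_hit_prob (u : 'I_n) :
  (A 1 u)%:R ^+ 2 * hit_prob R n A u = (closed_wedges u)%:R.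
Proof.
have n0 : (0 < n)%N by case: n u => // -[].
have [d0|d0] := posnP (A 1 u).
  have nb0 : neighbours u = [::] by apply: size0nil.
  rewrite d0 expr0n mul0r /closed_wedges big_pred0// => v.
  apply/negbTE/negP => uv; suff : val v \in neighbours u by rewrite nb0.
  by rewrite mem_neighbours.
have dE := maxn_idPr d0.
have dR : (A 1 u)%:R != 0 :> R by rewrite pnatr_eq0 -lt0n.
rewrite /hit_prob /average dE size_iota.
rewrite -mulr_suml -[in LHS]mulrA -invfM -expr2 mulrC mulfVK ?expf_neq0//.
have sumE (F : nat -> R) : \sum_(v in G u) F v =
    \sum_(a <- iota 0 (A 1 u)) F (nth 0%N (neighbours u) a).
  transitivity (\sum_(x <- neighbours u) F x).
    by rewrite neighboursE big_map big_enum.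
  by rewrite (big_nth 0%N) /index_iota subn0.
rewrite /closed_wedges natr_sum.
rewrite (eq_bigr (fun v : 'I_n => \sum_(b <- iota 0 (A 1 u))
   (nth 0%N (neighbours u) b \in neighbours v)%:R)) => [|v _].
  rewrite (sumE (fun x => \sum_(b <- iota 0 (A 1 u))
    (nth 0%N (neighbours u) b \in neighbours x)%:R)).
  apply: eq_big_seq => a; rewrite mem_iota => /andP[_ alt].
  apply: eq_big_seq => b; rewrite mem_iota => /andP[_ blt].
  by rewrite input_hit// dE.
rewrite natr_sum -(sumE (fun y => (y \in neighbours v)%:R)).
by apply: eq_bigr => w _; rewrite mem_neighbours.
Qed.

Lemma hit_prob_ge0 u : 0 <= hit_prob R n A u.
Proof. by apply: average_ge0 => a; apply: average_ge0. Qed.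

Lemma hit_prob_le1 u : hit_prob R n A u <= 1.
Proof.
have l0 : (0 < size (iota 0 (maxn 1 (A 1 u))))%N by rewrite size_iota leq_max.
rewrite -[leRHS](average_const 1 l0); apply: le_average => a.
rewrite -[leRHS](average_const 1 l0); apply: le_average => b.
by rewrite lern1 leq_b1.
Qed.

(** * Mean and variance of the counter *)

Lemma nsamples_gt0 u : (0 < nsamples n A u)%N.
Proof. by rewrite /nsamples addn1. Qed.

Lemma nsamples_weight_le_sqr u :
  (nsamples n A u)%:R * (weight n A u)%:R <= (A 1 u)%:R ^+ 2 :> R.
Proof. by rewrite -natrM -natrX ler_nat mulnC expnS expn1 leq_divM. Qed.

Lemma sqr_le_nsamples_weight u : (A 1 u)%:R ^+ 2 <=
  (nsamples n A u)%:R * (weight n A u)%:R + (nsamples n A u)%:R :> R.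
Proof.
rewrite -natrM -natrD -natrX ler_nat expnS expn1 ltnW//.
by rewrite addnC -mulnS mulnC ltn_ceil ?nsamples_gt0.
Qed.

Lemma degree_sum_input : degree_sum n A = (\sum_(u < n) #|G u|)%N.
Proof.
rewrite /degree_sum big_mkord; apply: eq_bigr => u _.
by rewrite input_degree neighboursE size_map -cardE.
Qed.

(** With degree [d], [s] samples and degree sum [M], rounding up gives [d * n < s * M], so
    [w * s <= d ^ 2 <= d * n < s * M]. *)
Lemma weight_le_degree_sum (u : 'I_n) : (weight n A u <= degree_sum n A)%N.
Proof.
have du : (A 1 u <= degree_sum n A)%N.
  rewrite degree_sum_input (bigD1 u)// input_degree neighboursE size_map -cardE.
  exact: leq_addr.
have [M0|M0] := posnP (degree_sum n A).
  by rewrite M0 /weight; move: du; rewrite M0 leqn0 => /eqP->; rewrite div0n.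
rewrite -(leq_pmul2r (nsamples_gt0 u)); apply: leq_trans (leq_divM _ _) _.
apply: (@leq_trans (A 1 u * n)%N); first by rewrite leq_mul2l size_neighbours_le orbT.
by rewrite /nsamples addn1 [leqRHS]mulnC ltnW// -ltn_divLR.
Qed.

Lemma sum_closed_wedgesR :
  \sum_(u < n) (closed_wedges u)%:R = 6 * (nb_triangles G)%:R :> R.
Proof. by rewrite -natr_sum sum_closed_wedges natrM. Qed.

Local Notation t := ((nb_triangles G)%:R : R).
Local Notation m := ((nb_edges G)%:R : R).

(** Rounding the weight down loses less than 1 per sample, and there are at most [2n] samples. *)
Lemma mean_from_bounds : 6 * t - 2 * n%:R <= mean_from R n A 0 <= 6 * t.
Proof.
rewrite /mean_from big_mkord -sum_closed_wedgesR.
apply/andP; split; last first.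
  apply: ler_sum => u _; rewrite -degree_hit_prob.
  by rewrite ler_wpM2r ?hit_prob_ge0 ?nsamples_weight_le_sqr.
rewrite lerBlDr.
apply: (@le_trans _ _ (\sum_(u < n)
  ((nsamples n A u)%:R * (weight n A u)%:R * hit_prob R n A u
   + (nsamples n A u)%:R))).
  apply: ler_sum => u _; rewrite -degree_hit_prob.
  apply: le_trans (ler_wpM2r (hit_prob_ge0 u) (sqr_le_nsamples_weight u)) _.
  by rewrite mulrDl lerD2l ler_piMr ?hit_prob_le1.
rewrite big_split/= lerD2l -natr_sum -natrM ler_nat.
by have := @sum_nsamples_le n A; rewrite big_mkord; apply.
Qed.

(** One factor [w] is bounded by the degree sum, at most [2m]; what is left is at most the ideal
    mean [6t]. *)
Lemma variance_from_le : variance_from R n A 0 <= 12 * m * t.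
Proof.
rewrite /variance_from big_mkord.
have -> : 12 * m * t = (2 * m) * \sum_(u < n) (closed_wedges u)%:R.
  by rewrite sum_closed_wedgesR; ring.
rewrite mulr_sumr; apply: ler_sum => u _; rewrite -degree_hit_prob mulrA.
rewrite ler_wpM2r ?hit_prob_ge0// expr2 mulrA mulrC.
apply: ler_pM => //; last exact: nsamples_weight_le_sqr.
rewrite -natrM ler_nat; apply: leq_trans (weight_le_degree_sum u) _.
by rewrite degree_sum_input sum_degree_le.
Qed.

Lemma wedge_sampling_graph_run W Q c T (Den : R) :
  (0 < n)%N -> ((n + 2) ^ 3 <= W)%N -> 0 < Den ->
  (forall s, (var s 6 <= n ^ 3)%N ->
     ((0 < var s 6)%N -> triangle_at (var s 7) (var s 8) (var s 9)) ->
     bounded_run W Q T (((var s 6)%:R - mean_from R n A 0) ^+ 2 / Den) ([:: c], s)) ->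
  bounded_run W Q (48 * n + 6 + T) (12 * m * t / Den)
    ([:: wedge_sampling c], graph_input G).
Proof.
move=> n0 Wn D0 final.
apply: (@bounded_run_weaken _ _ _ (48 * n + 6 + T) _ (variance_from R n A 0 / Den)) => //.
  by rewrite ler_pM2r ?invr_gt0// variance_from_le.
apply: (@wedge_sampling_run _ _ _ _ triangle_at) => //.
- by move=> u; apply: size_neighbours_le.
- by move=> k; apply: neighbour_lt.
- by move=> k; apply: leq_b1.
- exact: input_hit_triangle.
- by move=> s _; apply: final.
Qed.

(** * Reading off the estimate and the triangle *)

Definition estimate_cmd : cmd := Assign 0 (Bin Div (Var 6) (Const 6)).

Definition triangle_cmd : cmd :=
  Seq (Assign 0 (Var 7)) (Seq (Assign 1 (Var 8)) (Assign 2 (Var 9))).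

Lemma sqr_lt_itv (x y : R) : 0 < y -> x ^+ 2 / y ^+ 2 < 1 -> - y < x < y.
Proof.
move=> y0; rewrite ltr_pdivrMr ?exprn_gt0// mul1r => xy.
rewrite -ltr_norml -(@ltr_pXn2r _ 2)// ?nnegrE ?ltW//.
by rewrite real_normK ?num_real.
Qed.

(** Of the tolerance [6 * e * t] on the counter, half goes to the random deviation and half to
    rounding: [2n] in the mean and at most 5 in the division by 6. *)
Lemma estimate_cmd_run W (e : R) s :
  (0 < n)%N -> ((n + 2) ^ 3 <= W)%N -> (var s 6 <= n ^ 3)%N ->
  0 < e * t -> 2 * n%:R + 6 <= 3 * (e * t) ->
  bounded_run W (estimate_ok e G) 1
    (((var s 6)%:R - mean_from R n A 0) ^+ 2 / (3 * (e * t)) ^+ 2)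
    ([:: estimate_cmd], s).
Proof.
move=> n0 Wn s6 et0 nt; have et3 : 0 < 3 * (e * t) by lra.
exec_step; apply: bounded_run_nil; first by rewrite divr_ge0 ?sqr_ge0.
move=> /(sqr_lt_itv et3) /andP[lo hi].
have /andP[mlo mhi] := mean_from_bounds.
have Wlt : (n ^ 3 + 6 < W)%N by nia.
have xE : eval W s (Bin Div (Var 6) (Const 6)) = (var s 6 %/ 6)%N.
  rewrite /= [(6 %% W)%N]modn_small; last by lia.
  by rewrite modn_small// (leq_ltn_trans (leq_div _ _))//; lia.
suff : (1 - e) * t <= (var s 6 %/ 6)%:R <= (1 + e) * t by rewrite -xE.
have xlo : (var s 6)%:R <= 6 * (var s 6 %/ 6)%:R + 5 :> R.
  by rewrite -natrM -natrD ler_nat; lia.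
have xhi : 6 * (var s 6 %/ 6)%:R <= (var s 6)%:R :> R.
  by rewrite -natrM ler_nat; lia.
by apply/andP; split; lra.
Qed.

(** A zero counter would deviate from the mean by at least [6t - 2n], which exceeds the allowed
    [3t / 2]; hence some sample hit. *)
Lemma triangle_cmd_run W s :
  ((0 < var s 6)%N -> triangle_at (var s 7) (var s 8) (var s 9)) ->
  0 < t -> 4 * n%:R <= 3 * t ->
  bounded_run W (triangle_ok G) 5
    (((var s 6)%:R - mean_from R n A 0) ^+ 2 / (3 * (1 / 2 * t)) ^+ 2)
    ([:: triangle_cmd], s).
Proof.
move=> tri t0 nt; have et3 : 0 < 3 * (1 / 2 * t) by lra.
do 5 exec_step; apply: bounded_run_nil; first by rewrite divr_ge0 ?sqr_ge0.
move=> /(sqr_lt_itv et3) /andP[lo hi].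
have /andP[mlo mhi] := mean_from_bounds.
have [s0|/tri//] := posnP (var s 6).
by move: lo; rewrite s0; lra.
Qed.

End GraphInput.

(** * Asymptotics *)

Section Asymptotics.
Variables (R : realType) (delta c1 c2 : R).
Hypotheses (delta_gt0 : 0 < delta) (c1_gt0 : 0 < c1) (c2_gt0 : 0 < c2).

Lemma dense_edges_ge n (G : sgraph n) : (0 < n)%N -> dense_class delta c1 c2 G ->
  c1 * n%:R <= (nb_edges G)%:R.
Proof.
move=> n0 [mge _]; apply: le_trans mge; rewrite ler_pM2l//.
rewrite -[leLHS]powRr1 ?ler0n// ler_powR ?ler1n// lerDl.
by rewrite mulr_ge0 ?divr_ge0 ?ler0n ?(ltW delta_gt0).
Qed.

(** The factor [m ^ delta] in the lower bound on [t] exceeds any [L], because [m >= c1 * n] grows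
    with [n]. *)
Lemma dense_triangles_ge (L : R) : exists n0 : nat, forall n (G : sgraph n),
  (n0 <= n)%N -> dense_class delta c1 c2 G ->
  (0 < n)%N /\ c2 * L * (nb_edges G)%:R <= (nb_triangles G)%:R.
Proof.
(* Makes the constant nonnegative, so that it is the [delta]-th power of its root. *)
pose L1 := Num.max L 1.
pose n0 := (Num.truncn (L1 `^ delta^-1 / c1)).+1.
exists n0 => n G nn dG; have n_gt0 : (0 < n)%N by apply: leq_trans nn.
split=> //; have mge := dense_edges_ge n_gt0 dG; have [_ tge] := dG.
have m0 : 0 < (nb_edges G)%:R :> R.
  by apply: lt_le_trans mge; rewrite mulr_gt0// ltr0n.
apply: le_trans tge; rewrite -mulrA ler_pM2l//.
rewrite powRD; last by apply/implyP => _; rewrite gt_eqF.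
rewrite powRr1 ?ler0n// mulrC ler_pM2l//.
apply: (@le_trans _ _ L1); first by rewrite le_max lexx.
have L10 : 0 <= L1 by rewrite le_max ler01 orbT.
have -> : L1 = (L1 `^ delta^-1) `^ delta by rewrite -powRrM mulVf ?gt_eqF// powRr1.
apply: ge0_ler_powR; rewrite ?nnegrE ?powR_ge0 ?ler0n ?(ltW delta_gt0)//.
apply: le_trans mge; rewrite mulrC -ler_pdivrMr//.
by apply: le_trans (ltW (truncnS_gt _)) _; rewrite ler_nat.
Qed.

(** Both exponents are at least 1: [omega * (1 - delta) >= 3 / 2], and
    [2 * omega / (omega + 1) >= 1] over a base of at least [c1 * n], since [3.82 * delta] outweighs
    [2 * delta]. *)
Lemma bound_ge_linear (omega : R) (B : nat -> nat -> R) :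
  2 <= omega -> delta <= 1 / 4 ->
  B = vertex_bound omega delta \/ B = edge_bound omega delta ->
  exists2 C : R, 0 < C & forall n (G : sgraph n), (0 < n)%N ->
    dense_class delta c1 c2 G -> n%:R <= C * B n (nb_edges G).
Proof.
move=> om de [->|->].
  exists 1 => // n G n0 _; rewrite mul1r /vertex_bound.
  rewrite -[leLHS]powRr1 ?ler0n// ler_powR ?ler1n//; nra.
pose e := 2 * omega / (omega + 1).
have e1 : 1 <= e by rewrite /e ler_pdivlMr; lra.
have ce : 0 < c1 `^ e by rewrite powR_gt0.
exists (c1 `^ e)^-1 => [|n G n0 [mge _]]; first by rewrite invr_gt0.
rewrite ler_pdivlMl// /edge_bound -/e.
have nge : n%:R <= n%:R `^ e.
  by rewrite -[leLHS]powRr1 ?ler0n// ler_powR ?ler1n.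
apply: (@le_trans _ _ (c1 `^ e * n%:R `^ e)); first by rewrite ler_pM2l.
rewrite -powRM ?ler0n ?(ltW c1_gt0)//.
have nR : 0 < n%:R :> R by rewrite ltr0n.
have n0R : n%:R != 0 :> R by rewrite gt_eqF.
have e0 : 0 <= e by apply: le_trans e1.
apply: ge0_ler_powR => //.
- by rewrite nnegrE mulr_ge0 ?(ltW c1_gt0) ?ler0n.
- by rewrite nnegrE mulr_ge0 ?powR_ge0 ?ler0n.
apply: (@le_trans _ _ (c1 * n%:R `^ (1 + 382 / 100 * delta)
  * n%:R `^ (- (2 * delta)))); last first.
  by rewrite ler_pM2r ?powR_gt0.
rewrite -mulrA ler_pM2l// -powRD; last by apply/implyP.
rewrite -[leLHS]powRr1 ?ler0n// ler_powR ?ler1n//.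
have : 2 * delta <= 382 / 100 * delta.
  by rewrite ler_pM2r// ler_pdivlMr// -natrM ler_nat.
by set x := 382 / 100 * delta; lra.
Qed.

Lemma dense_class_large (eps eta : R) : 0 < eps -> 0 < eta ->
  exists n0 : nat, forall n (G : sgraph n), (n0 <= n)%N ->
    dense_class delta c1 c2 G ->
    let t := (nb_triangles G)%:R : R in
    [/\ (0 < n)%N, 0 < t, 8 * n%:R <= 3 * (eps * t) &
        12 * (nb_edges G)%:R * t / (3 * (eps * t)) ^+ 2 <= eta].
Proof.
move=> e0 h0.
(* The first summand pushes the variance ratio [4m / (3 * eps ^ 2 * t)] below [eta]; the second
   gives [8n <= 3 * eps * t]. *)
pose L := 4 / (3 * eps ^+ 2 * c2 * eta) + 8 / (3 * eps * c2 * c1).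
have a0 : 0 < 3 * eps ^+ 2 * c2 * eta by rewrite !mulr_gt0 ?exprn_gt0.
have b0 : 0 < 3 * eps * c2 * c1 by rewrite !mulr_gt0.
have L1 : 4 <= L * (3 * eps ^+ 2 * c2 * eta).
  by rewrite -ler_pdivrMr// lerDl divr_ge0 ?ltW.
have L2 : 8 <= L * (3 * eps * c2 * c1).
  by rewrite -ler_pdivrMr// lerDr divr_ge0 ?ltW.
have [n0 H] := dense_triangles_ge L.
exists n0 => n G nn dG t; have [n_gt0 tge] := H n G nn dG.
have mge := dense_edges_ge n_gt0 dG.
set m := (nb_edges G)%:R in tge mge *; rewrite -/t in tge.
have nR : 0 < n%:R :> R by rewrite ltr0n.
have m0 : 0 < m by apply: lt_le_trans mge; rewrite mulr_gt0.
have L0 : 0 < L by rewrite -(pmulr_lgt0 _ a0); apply: lt_le_trans L1.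
have t0 : 0 < t by apply: lt_le_trans tge; rewrite !mulr_gt0.
split=> //.
  apply: (@le_trans _ _ (3 * (eps * (c2 * L * (c1 * n%:R))))).
    rewrite [leRHS](_ : _ = L * (3 * eps * c2 * c1) * n%:R); last by ring.
    by rewrite ler_pM2r.
  rewrite !ler_pM2l//; apply: le_trans tge; rewrite ler_pM2l ?mulr_gt0//.
rewrite ler_pdivrMr ?exprn_gt0 ?mulr_gt0//.
have -> : eta * (3 * (eps * t)) ^+ 2 = 3 * ((3 * eps ^+ 2 * eta) * t) * t by ring.
rewrite ler_pM2r// (_ : 12 * m = 3 * (4 * m)); last by ring.
rewrite ler_pM2l//; apply: (@le_trans _ _ ((3 * eps ^+ 2 * eta) * (c2 * L * m))).
  rewrite [leRHS](_ : _ = L * (3 * eps ^+ 2 * c2 * eta) * m); last by ring.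
  by rewrite ler_pM2r.
by rewrite ler_pM2l// !mulr_gt0 ?exprn_gt0.
Qed.

End Asymptotics.

(** * Running time and assembly *)

Lemma wedge_sampling_time (R : realType) n (G : sgraph n) W c T :
  (0 < n)%N -> ((n + 2) ^ 3 <= W)%N -> (T <= 5)%N ->
  (forall s, bounded_run W setT T (0 : R) ([:: c], s)) ->
  (expected_time R W (wedge_sampling c) (graph_input G) <= (59 * n%:R)%:E)%E.
Proof.
move=> n0 Wn T5 run.
have runG := @wedge_sampling_graph_run R n G W setT c T 1 n0 Wn ltr01.
apply: le_trans (expected_time_le (runG _)) _ => [s _ _|].
  apply: bounded_run_weaken (run s) => //.
  by rewrite divr_ge0 ?sqr_ge0.
by rewrite lee_fin -natrM ler_nat; lia.
Qed.

Theorem theorem3 (R : realType) (omega delta : R)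
    (homega : mm_in_time omega) (homega_lt : omega < 2376 / 1000)
    (hdelta : 0 < delta <= 1 / 4)
    (B : nat -> nat -> R)
    (hB : B = vertex_bound omega delta \/ B = edge_bound omega delta) :
  (exists estimator : R -> algorithm,
     forall c1 c2 : R, 0 < c1 -> 0 < c2 ->
       (forall eps : R, 0 < eps <= 1 / 2 ->
          whp R (estimator eps) (dense_class delta c1 c2)
            (fun n G => estimate_ok eps G)) /\
       (exists (n0 : nat) (C : R),
          forall eps : R, 0 < eps <= 1 / 2 ->
            time_le (estimator eps) (dense_class delta c1 c2) n0
              (C * eps ^- 2) B)) /\
  (exists finder : algorithm,
     forall c1 c2 : R, 0 < c1 -> 0 < c2 ->
       whp R finder (dense_class delta c1 c2)
         (fun n G => triangle_ok G) /\
       (exists (n0 : nat) (C : R),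
          time_le finder (dense_class delta c1 c2) n0 C B)).
Proof.
have om2 := mm_exponent_ge2 homega.
have /andP[d0 d14] := hdelta.
split.
  (* One program serves every [eps], which enters only through the denominator in Chebyshev's bound.
     The word exponent 3 accommodates the cubic bound on the counter. *)
  exists (fun=> Algorithm (wedge_sampling estimate_cmd) 3) => c1 c2 c10 c20; split.
    move=> eps /andP[e0 _] eta h0.
    have [n0 H] := dense_class_large d0 c10 c20 e0 h0.
    exists n0 => n G W nn dG Wn; have [n_gt0 t0 nt var_le] := H n G nn dG.
    have et : 0 < eps * (nb_triangles G)%:R by rewrite mulr_gt0.
    have n1 : 1 <= n%:R :> R by rewrite ler1n.
    have run := @wedge_sampling_graph_run R n G W (estimate_ok eps G) estimate_cmd 1
      ((3 * (eps * (nb_triangles G)%:R)) ^+ 2) n_gt0 Wn.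
    apply: le_trans (success_prob_ge (run _ _)).
    - by rewrite lerD2l lerN2.
    - by rewrite exprn_gt0// mulr_gt0.
    - by move=> s s6 _; apply: estimate_cmd_run => //; lra.
  have [C C0 nle] := @bound_ge_linear R delta c1 c2 d0 c10 omega B om2 d14 hB.
  exists 1%N, (59 * C) => eps /andP[e0 e12] n G W n_gt0 dG Wn.
  apply: le_trans (@wedge_sampling_time R n G W _ 1 n_gt0 Wn isT _) _.
    move=> s; exec_step.
    exact: bounded_run_nil.
  have nB := nle n G n_gt0 dG; rewrite lee_fin.
  have -> : 59 * C * eps ^- 2 * B n (nb_edges G) =
    59 * (C * B n (nb_edges G)) * eps ^- 2 by ring.
  apply: (@le_trans _ _ (59 * (C * B n (nb_edges G)))); first by rewrite ler_pM2l.
  rewrite ler_peMr//; first by rewrite mulr_ge0// (le_trans _ nB).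
  (* As [eps <= 1 / 2], the factor [eps ^- 2] only enlarges the bound. *)
  rewrite invf_ge1 ?exprn_gt0//; nra.
exists (Algorithm (wedge_sampling triangle_cmd) 3) => c1 c2 c10 c20; split.
  move=> eta h0.
  (* Accuracy 1/2 already keeps the counter away from 0. *)
  have e0 : 0 < 1 / 2 :> R by lra.
  have [n0 H] := dense_class_large d0 c10 c20 e0 h0.
  exists n0 => n G W nn dG Wn; have [n_gt0 t0 nt var_le] := H n G nn dG.
  have run := @wedge_sampling_graph_run R n G W (triangle_ok G) triangle_cmd 5
    ((3 * (1 / 2 * (nb_triangles G)%:R)) ^+ 2) n_gt0 Wn.
  apply: le_trans (success_prob_ge (run _ _)).
  - by rewrite lerD2l lerN2.
  - by rewrite exprn_gt0// !mulr_gt0.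
  - have n1 : 1 <= n%:R :> R by rewrite ler1n.
    by move=> s _ tri; apply: triangle_cmd_run => //; lra.
have [C C0 nle] := @bound_ge_linear R delta c1 c2 d0 c10 omega B om2 d14 hB.
exists 1%N, (59 * C) => n G W n_gt0 dG Wn.
apply: le_trans (@wedge_sampling_time R n G W _ 5 n_gt0 Wn isT _) _.
  move=> s; do 5 (exec_step).
  exact: bounded_run_nil.
by rewrite lee_fin -mulrA ler_pM2l// nle.
Qed.
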